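(* Let $X$ be a real Banach space, $Y$ a Banach space, $f_i\colon X\to\mathbb{R}$, $i\in I_0=\{0\}\cup I$, $I=\{1,\ldots,n\}$. Let a mapping $F\colon X\to Y$ be continuously Fr\'echet differentiable at a point $x^*\in X$, and let the functions $f_i$, $i\in I_0$, be Fr\'echet codifferentiable at $x^*$. Suppose that the Fr\'echet derivative $F'[x^*]$ of $F$ at $x^*$ is surjective, and $x^*$ is a point of local minimum in the problem $$f_0(x)\to\inf,\quad F(x)=0,\quad f_i(x)\le0,\quad i\in I.$$ Then for any $(0,q_i)\in\overline{d}f_i(x^* )$, $i\in R(x^* )$, there exists $y^*\in Y^*$ such that $$(0,\,y^*\circ F'[x^*])\in\operatorname{co}\bigcup_{i\in R(x^* )}\big(\underline{d}f_i(x^* )+\{(0,q_i)\}\big).$$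
   Context: $R(x)=\{0\}\cup\{i\in I\mid f_i(x)=0\}$; $\operatorname{co}$ is the convex hull; $X^*$, $Y^*$ are the topological duals. A function $f\colon X\to\mathbb{R}$ is Fr\'echet (strongly) codifferentiable at $x$ if there exist nonempty convex bounded sets $\underline{d}f(x),\overline{d}f(x)\subset\mathbb{R}\times X^*$, compact in the product of the standard topology of $\mathbb{R}$ and the weak${}^*$ topology of $X^*$, such that for $\Delta x\in X$ $$f(x+\Delta x)-f(x)=\max_{(a,p)\in\underline{d}f(x)}(a+p(\Delta x))+\min_{(b,q)\in\overline{d}f(x)}(b+q(\Delta x))+o(\Delta x,x),$$ where $o(\Delta x,x)/\|\Delta x\|\to0$ as $\Delta x\to0$. Such sets $\underline d f(x),\overline d f(x)$ are fixed and normalized so that $\max_{(a,p)\in\underline{d}f(x)}a=0$ and $\min_{(b,q)\in\overline{d}f(x)}b=0$. *)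

(* Defs.v *)
From HB Require Import structures.
From mathcomp Require Import all_boot all_order all_algebra.
From mathcomp Require Import all_classical all_reals all_analysis.

Set Implicit Arguments.
Unset Strict Implicit.
Unset Printing Implicit Defensive.

Import Order.TTheory GRing.Theory Num.Theory.
Import numFieldNormedType.Exports.

Local Open Scope classical_set_scope.
Local Open Scope ring_scope.

Definition is_max (R : realType) (S : set R) (m : R) : Prop := S m /\ ubound S m.

Definition is_min (R : realType) (S : set R) (m : R) : Prop := S m /\ lbound S m.

Definition convex_hull (R : realType) (V : lmodType R) (A : set V) : set V :=
  \bigcap_(C in [set C : set V | convex_set C /\ A `<=` C]) C.

(* The topological dual is a linear subspace of the space of all functions
   X -> R, and its weak-star topology is induced by the topology of pointwise
   convergence {ptws X -> R^o}. Subsets of the product of R and the dual are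
   represented as subsets of R^o * (X -> R^o) whose second components lie in
   the dual; convexity and compactness do not depend on the ambient space. *)
Definition dual (R : realType) (X : normedModType R) : set (X -> R^o) :=
  [set p | linear p /\ continuous p].

Section Codifferential.
Context {R : realType} {X : normedModType R}.
Implicit Types (f : X -> R) (x : X) (A : set (R^o * (X -> R^o))).

(* [uniform_bounded] (bounded on each ball, uniformly over the set of
   functionals) is boundedness in the norm of the dual. *)
Record codiff_set A : Prop := {
  codiff_set_dual : A `<=` [set ap | dual ap.2] ;
  codiff_set_nonempty : A !=set0 ;
  codiff_set_convex : convex_set A ;
  codiff_set_bounded : bounded_set (fst @` A) /\ uniform_bounded (snd @` A) ;
  codiff_set_compact : compact (A : set (R^o * {ptws X -> R^o})) }.

(* The pair (dl, du) of a hypodifferential and a hyperdifferential is a Frechet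
   codifferential of f at x. The functions Phi and Psi are the pointwise
   maximum and minimum of the two families of affine functions. *)
Definition is_codifferential f x (dl du : set (R^o * (X -> R^o))) : Prop :=
  [/\ codiff_set dl, codiff_set du &
    exists Phi Psi : X -> R,
      [/\ forall dx, is_max [set ap.1 + ap.2 dx | ap in dl] (Phi dx),
          forall dx, is_min [set bq.1 + bq.2 dx | bq in du] (Psi dx) &
          (fun dx : X => f (x + dx) - f x - (Phi dx + Psi dx) : R^o)
            =o_ (0 : X) id]].

Definition codiff_normalized (dl du : set (R^o * (X -> R^o))) : Prop :=
  is_max (fst @` dl) 0 /\ is_min (fst @` du) 0.

End Codifferential.

(* F is differentiable near x and its derivative is continuous at x in the
   operator norm: the last inequality says `|'d F z - 'd F x| <= e. *)
Definition continuously_differentiable_at (R : realType)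
    (X Y : normedModType R) (F : X -> Y) (x : X) : Prop :=
  (\forall z \near x, differentiable F z) /\
  (forall e : R, 0 < e -> \forall z \near x,
     forall h : X, `|'d F z h - 'd F x h| <= e * `|h|).

(* The index ord0 is the objective; the other indices are the constraints. *)
Section Problem.
Context {R : realType} {X Y : normedModType R} {n : nat}.
Variables (f : 'I_n.+1 -> X -> R) (F : X -> Y).

Definition feasible (x : X) : Prop :=
  F x = 0 /\ forall i : 'I_n.+1, i != ord0 -> f i x <= 0.

Definition local_minimum (x : X) : Prop :=
  feasible x /\ \forall z \near x, feasible z -> f ord0 x <= f ord0 z.

Definition active (x : X) : set 'I_n.+1 :=
  [set ord0] `|` [set i | i != ord0 /\ f i x = 0].

End Problem.

(* Main.v *)
(* Lyusternik's theorem gives, for every v in the kernel of F'[x*], a path in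
   F = 0 tangent to v at x*. If all the functions v |-> a + p v, for (a, p) in
   the union S of the sets dl_i + (0, q_i) over the active indices, were negative
   at such a v, then f_0 and the active constraints would strictly decrease along
   the path, because q_i bounds the hyperdifferential part from above and a <= 0
   makes the hypodifferential part subhomogeneous; this contradicts minimality.
   So for each v in the kernel some (a, p) in co S has a + p v >= 0. As co S is
   compact, a minimax argument yields one (a, p) in co S that works for all v in
   the kernel. Taking v = 0 gives a = 0, replacing v by - v shows that p vanishes
   on the kernel, and the open mapping theorem factors p through F'[x*]. *)
Require Import Defs.
From HB Require Import structures.
From mathcomp Require Import all_boot all_order all_algebra.
From mathcomp Require Import all_classical all_reals all_analysis.
From mathcomp Require Import ring lra.
Import Order.TTheory GRing.Theory Num.Theory.
Import numFieldNormedType.Exports.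
Local Open Scope classical_set_scope.
Local Open Scope ring_scope.

(** * Minimax *)

Section Minimax.
Variables (R : realType) (T : topologicalType).
Implicit Types (K : set T) (f g : T -> R).

Lemma compact_superlevel K f : compact K -> continuous f ->
  compact (K `&` [set k | 0 <= f k]).
Proof.
move=> cK cf; apply: compact_closedI => //.
by apply: (@preimage_closed _ _ f [set x | 0 <= x]) => // _ _; exact: cf.
Qed.

(** Otherwise the image of [K] under [(f, g)] misses the closed first quadrant. It is convex up to
    an increase of coordinates, so its extreme slopes leave room for a line through the origin with
    the whole image strictly below it, against the hypothesis on weighted sums. *)
Lemma two_function_minimax K f g : compact K -> continuous f -> continuous g ->
  (forall k l (s : R), K k -> K l -> 0 <= s <= 1 -> exists m,
    [/\ K m, (1 - s) * f k + s * f l <= f m & (1 - s) * g k + s * g l <= g m]) ->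
  (forall s : R, 0 <= s <= 1 -> exists2 k, K k & 0 <= (1 - s) * f k + s * g k) ->
  exists k, [/\ K k, 0 <= f k & 0 <= g k].
Proof.
move=> cK cf cg concK someK; apply: contrapT => none.
have g_lt0 k : K k -> 0 <= f k -> g k < 0.
  by move=> Kk fk; rewrite ltNge; apply/negP => gk; apply: none; exists k.
have f_lt0 k : K k -> 0 <= g k -> f k < 0.
  by move=> Kk gk; rewrite ltNge; apply/negP => fk; apply: none; exists k.
(* The segment from [(f k, g k)] to [(f l, g l)] passes below the origin. *)
have cross k l : K k -> K l -> 0 <= f k -> 0 <= g l -> f k * g l < g k * f l.
  move=> Kk Kl fk gl.
  have gk := g_lt0 _ Kk fk; have fl := f_lt0 _ Kl gl.
  have d_gt0 : 0 < f k - f l by lra.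
  have s01 : 0 <= f k / (f k - f l) <= 1.
    by rewrite divr_ge0 ?(ltW d_gt0)//= ler_pdivrMr// mul1r; lra.
  have [m [Km fm gm]] := concK _ _ _ Kk Kl s01.
  have ce : 1 - f k / (f k - f l) = - f l / (f k - f l) by field; lra.
  rewrite {}ce in fm gm.
  have f0 : - f l / (f k - f l) * f k + f k / (f k - f l) * f l = 0 by ring.
  rewrite f0 in fm; have gm0 := g_lt0 _ Km fm.
  have := le_lt_trans gm gm0.
  have -> : - f l / (f k - f l) * g k + f k / (f k - f l) * g l =
            (f k * g l - g k * f l) / (f k - f l) by ring.
  by rewrite pmulr_llt0 ?invr_gt0// subr_lt0.
have [k0 [Kk0 fk0]] : exists k, K k /\ 0 <= f k.
  have [|k Kk] := someK 0; first by rewrite lexx ler01.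
  by rewrite subr0 mul1r mul0r addr0; exists k.
have [l0 [Kl0 gl0]] : exists l, K l /\ 0 <= g l.
  have [|l Kl] := someK 1; first by rewrite lexx ler01.
  by rewrite subrr mul1r mul0r add0r; exists l.
(* On this compact part [g] is negative, so the quotient is continuous and attains its maximum;
   likewise below with the roles exchanged. *)
have [k /set_mem[/= Kk fk] kmax] : exists2 k, k \in K `&` [set k | 0 <= f k] &
    forall l, l \in K `&` [set k | 0 <= f k] -> f l / - g l <= f k / - g k.
  apply: (@compact_EVT_max _ _ (fun k => f k / - g k)).
  - by exists k0.
  - exact: compact_superlevel.
  - rewrite continuous_subspace_in => x /set_mem[/= Kx fx].
    apply: (@continuous_subspaceT_for _ _ _ (fun k => f k / - g k)).
      by split.
    apply: cvgM; first exact: cf.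
    by apply: cvgV; [rewrite oppr_eq0 lt_eqF// g_lt0 | apply: cvgN; exact: cg].
have [l /set_mem[/= Kl gl] lmax] : exists2 k, k \in K `&` [set k | 0 <= g k] &
    forall l, l \in K `&` [set k | 0 <= g k] -> g l / - f l <= g k / - f k.
  apply: (@compact_EVT_max _ _ (fun k => g k / - f k)).
  - by exists l0.
  - exact: compact_superlevel.
  - rewrite continuous_subspace_in => x /set_mem[/= Kx fx].
    apply: (@continuous_subspaceT_for _ _ _ (fun k => g k / - f k)).
      by split.
    apply: cvgM; first exact: cg.
    by apply: cvgV; [rewrite oppr_eq0 lt_eqF// f_lt0 | apply: cvgN; exact: cf].
have := cross _ _ Kk Kl fk gl.
have gk := g_lt0 _ Kk fk; have fl := f_lt0 _ Kl gl => crosskl.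
set r := f k / - g k in kmax; set q := g l / - f l in lmax.
have r_ge0 : 0 <= r by rewrite divr_ge0// oppr_ge0 ltW.
have q_ge0 : 0 <= q by rewrite divr_ge0// oppr_ge0 ltW.
have rq : r * q < 1.
  have -> : r * q = (f k * g l) / (g k * f l) by rewrite /r /q; field; lra.
  by rewrite ltr_pdivrMr ?mul1r// nmulr_rgt0.
(* A slope strictly between [r] and [1 / q]; the product form also covers [q = 0]. *)
have [s [s_gt0 rs sq]] : exists s : R, [/\ 0 < s, r < s & s * q < 1].
  set d := (1 - r * q) / (2 * (1 + q)).
  have d_gt0 : 0 < d by apply: divr_gt0; lra.
  have dE : d * (2 * (1 + q)) = 1 - r * q by rewrite /d; field; lra.
  by exists (r + d); split; nra.
(* With this weight the sum is a positive multiple of [f m + s * g m], which the choice of [s] makes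
   negative on all of [K]. *)
have [|m Km] := someK (s / (1 + s)).
  by rewrite divr_ge0 ?ltW ?addr_gt0//= ltr_pdivrMr ?addr_gt0//; lra.
have -> : (1 - s / (1 + s)) * f m + s / (1 + s) * g m =
          (f m + s * g m) / (1 + s) by field; lra.
rewrite pmulr_lge0 ?invr_gt0 ?addr_gt0// leNgt => /negP; apply.
have [fm|fm] := leP 0 (f m).
  have gm := g_lt0 _ Km fm.
  have : f m / - g m <= r by apply: kmax; rewrite inE.
  rewrite ler_pdivrMr ?oppr_gt0// => frg.
  have : r * - g m < s * - g m by rewrite ltr_pM2r// oppr_gt0.
  lra.
have [gm|gm] := leP 0 (g m).
  have : g m / - f m <= q by apply: lmax; rewrite inE.
  rewrite ler_pdivrMr ?oppr_gt0// => gqf.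
  have h1 : s * g m <= s * (q * - f m) by rewrite ler_pM2l.
  have : s * q * - f m < 1 * - f m by rewrite ltr_pM2r// oppr_gt0.
  lra.
have : s * g m < 0 by rewrite pmulr_rlt0.
lra.
Qed.

(* Ky Fan's minimax theorem; the induction step of the finite intersection
   property is [two_function_minimax] on the compact set where the previous
   functions are nonnegative. *)
Lemma convexlike_minimax (W : eqType) (V : set W) (e : W -> T -> R) K :
  compact K -> K !=set0 -> (forall v, V v -> continuous (e v)) ->
  (forall k l (s : R), K k -> K l -> 0 <= s <= 1 -> exists2 m, K m &
    forall v, V v -> (1 - s) * e v k + s * e v l <= e v m) ->
  (forall v w (s : R), V v -> V w -> 0 <= s <= 1 -> exists2 u, V u &
    forall k, K k -> e u k <= (1 - s) * e v k + s * e w k) ->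
  (forall v, V v -> exists2 k, K k & 0 <= e v k) ->
  exists2 k, K k & forall v, V v -> 0 <= e v k.
Proof.
move=> cK K0 ce concK convV someK.
pose B (s : seq W) := K `&` [set k | forall v, v \in s -> 0 <= e v k].
(* The second half is the invariant: the constraints in [s] leave room for any single further
   one. *)
have BP s : (forall v, v \in s -> V v) ->
    compact (B s) /\ forall v, V v -> exists2 k, B s k & 0 <= e v k.
  elim: s => [_|w s IHs sV].
    have -> : B [::] = K by apply/seteqP; split => [k []|k Kk]; last by split.
    by split.
  have [|cB someB] := IHs; first by move=> v vs; apply: sV; rewrite inE vs orbT.
  have Vw : V w by apply: sV; rewrite mem_head.
  have BE : B (w :: s) = B s `&` [set k | 0 <= e w k].
    apply/seteqP; split => k /=.
      move=> [Kk kw]; split; last by apply: kw; rewrite mem_head.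
      by split => // v vs; apply: kw; rewrite inE vs orbT.
    move=> [[Kk ks] kw]; split => // v; rewrite inE => /predU1P[->//|].
    exact: ks.
  rewrite BE; split; first exact: compact_superlevel (ce _ Vw).
  move=> v Vv; have [||k l t [Kk ks] [Kl ls] t01|t t01|k [Bk wk vk]] :=
    @two_function_minimax (B s) (e w) (e v) cB.
  - exact: ce.
  - exact: ce.
  - have [m Km mP] := concK _ _ _ Kk Kl t01.
    exists m; split; [|exact: mP|exact: mP].
    split => // u us; have Vu : V u by apply: sV; rewrite inE us orbT.
    apply: le_trans (mP _ Vu); case/andP: t01 => t0 t1.
    by rewrite addr_ge0// mulr_ge0 ?subr_ge0//; [exact: ks|exact: ls].
  (* The invariant for [s] is applied to [u], which lies below the weighted sum on [K]. *)
  - have [u Vu uP] := convV _ _ _ Vw Vv t01.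
    have [k Bk uk] := someB _ Vu; exists k => //.
    by apply: le_trans uk (uP _ _); case: Bk.
  - by exists k.
(* The sets [B s] are directed downwards, so compactness gives them a common cluster point, and
   closedness of each superlevel set puts that point in it. *)
pose D := [set s : seq W | forall v, v \in s -> V v].
have FF : ProperFilter (filter_from D B).
  apply: filter_from_proper.
    apply: filter_from_filter; first by exists [::].
    move=> s t Ds Dt; exists (s ++ t).
      by move=> v; rewrite mem_cat => /orP[/Ds|/Dt].
    move=> k [Kk kst]; split; split => // v vs; apply: kst;
      by rewrite mem_cat vs ?orbT.
  (* The invariant yields a point of [B s] only through some member of [V]. If [V] is empty, so is
     [s], and any point of [K] serves. *)
  move=> s Ds; have [[v Vv]|noV] := pselect (exists v, V v).
    by have [k Bk _] := (BP s Ds).2 v Vv; exists k.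
  case: K0 => k Kk; exists k; split => // v /Ds Vv.
  by exfalso; apply: noV; exists v.
have [|k [Kk kcl]] := cK _ FF.
  by exists [::] => // k [].
exists k => // v Vv.
have : closed [set k | 0 <= e v k].
  by apply: (@preimage_closed _ _ (e v) [set x | 0 <= x]) => // x _; exact: (ce _ Vv x).
apply => U kU; apply: kcl => //; exists [:: v].
  by move=> w; rewrite inE => /eqP ->.
by move=> l [_ lv]; apply: lv; rewrite mem_head.
Qed.

End Minimax.

(** * Convex hulls of finite unions of compact convex sets *)

Section ConvexHull.
Variables (R : realType) (M : lmodType R).
Implicit Types A B C : set (convex_lmodType M).

Lemma convex_setP A :
  convex_set A <-> forall (x y : M) (s : R), A x -> A y -> 0 <= s <= 1 ->
    A ((1 - s) *: x + s *: y).
Proof.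
split=> [cA x y s Ax Ay /andP[s0 s1]|cA x y l /set_mem Ax /set_mem Ay].
  have := cA y x (Itv01 s0 s1) (mem_set Ay) (mem_set Ax).
  by rewrite inE addrC.
apply: mem_set; have := cA y x l%:num Ay Ax.
by rewrite addrC; apply; rewrite ge0 le1.
Qed.

Lemma convex_set_comb A (x y : M) (a b : R) : convex_set A -> A x -> A y ->
  0 <= a -> 0 <= b -> exists2 z : M, A z & a *: x + b *: y = (a + b) *: z.
Proof.
move=> /convex_setP cA Ax Ay a0 b0.
have [ab0|ab0] := eqVneq (a + b) 0.
  have [-> ->] : a = 0 /\ b = 0 by split; lra.
  by exists x => //; rewrite addr0 !scale0r addr0.
have ab_gt0 : 0 < a + b by rewrite lt_neqAle eq_sym ab0 addr_ge0.
exists ((1 - b / (a + b)) *: x + (b / (a + b)) *: y).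
  apply: cA => //; apply/andP; split; first by rewrite divr_ge0// ltW.
  by rewrite ler_pdivrMr// mul1r lerDr.
rewrite scalerDr !scalerA mulrBr mulr1 mulrC divfK//.
by rewrite addrK.
Qed.

Lemma convex_hull_convex A : convex_set (convex_hull A).
Proof.
apply/convex_setP => x y s Ax Ay s01 C [cC AC].
by move/convex_setP : (cC); apply => //; [exact: Ax|exact: Ay].
Qed.

Lemma sub_convex_hull A : A `<=` convex_hull A.
Proof. by move=> x Ax C [_]; exact. Qed.

Lemma convex_hull_min A B : convex_set B -> A `<=` B -> convex_hull A `<=` B.
Proof. by move=> cB AB x; apply. Qed.

Lemma convex_hull_id A : convex_set A -> convex_hull A = A.
Proof.
move=> cA; apply/seteqP; split; [exact: convex_hull_min|exact: sub_convex_hull].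
Qed.

(** Lets a finite union be absorbed one set at a time, each time as the hull of two convex sets. *)
Lemma convex_hullU A B :
  convex_hull (A `|` convex_hull B) = convex_hull (A `|` B).
Proof.
apply/seteqP; split; apply: convex_hull_min; try exact: convex_hull_convex.
  move=> x [Ax|]; first by apply: sub_convex_hull; left.
  apply: convex_hull_min; first exact: convex_hull_convex.
  by move=> y By; apply: sub_convex_hull; right.
move=> x [Ax|Bx]; apply: sub_convex_hull; [by left|right].
exact: sub_convex_hull.
Qed.

(** Takes a single triple so that a hull becomes the continuous image of a product. *)
Definition segment_point (z : R * (M * M)) : M :=
  (1 - z.1) *: z.2.1 + z.1 *: z.2.2.

(** The right side is already convex: in a combination of two segment points, [convex_set_comb]
    gathers the [A] parts and the [B] parts separately. Nonemptiness supplies the idle endpoint for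
    a point of [A] or [B] alone. *)
Lemma convex_hull_join A B : convex_set A -> convex_set B ->
    A !=set0 -> B !=set0 ->
  convex_hull (A `|` B) =
  segment_point @` ([set s | 0 <= s <= 1] `*` (A `*` B)).
Proof.
move=> cA cB [x0 Ax0] [y0 By0]; apply/seteqP; split.
  apply: convex_hull_min => [|z [Az|Bz]]; last 2 first.
  - exists (0, (z, y0)); first by split => //=; rewrite lexx ler01.
    by rewrite /segment_point/= subr0 scale1r scale0r addr0.
  - exists (1, (x0, z)); first by split => //=; rewrite lexx ler01.
    by rewrite /segment_point/= subrr scale1r scale0r add0r.
  apply/convex_setP => z1 z2 s [[t [x y]] /= [/andP[t0 t1] [Ax By]] <-{z1}].
  move=> [[t' [x' y']] /= [/andP[t'0 t'1] [Ax' By']] <-{z2}] /andP[s0 s1].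
  rewrite /segment_point/=.
  have [||z Az zE] := convex_set_comb A x x' ((1 - s) * (1 - t))
      (s * (1 - t')) cA Ax Ax'.
  - by rewrite mulr_ge0// subr_ge0.
  - by rewrite mulr_ge0// subr_ge0.
  have [||w Bw wE] := convex_set_comb B y y' ((1 - s) * t) (s * t') cB By By'.
  - by rewrite mulr_ge0// subr_ge0.
  - by rewrite mulr_ge0.
  (* The new parameter is the total weight of the [B] parts. *)
  exists ((1 - s) * t + s * t', (z, w)) => /=.
    split => //=; rewrite addr_ge0 ?mulr_ge0 ?subr_ge0//=.
    by nra.
  rewrite -wE.
  have -> : 1 - ((1 - s) * t + s * t') = (1 - s) * (1 - t) + s * (1 - t')
    by ring.
  by rewrite -zE !scalerDr !scalerA addrACA.
move=> _ [[s [x y]] [/= s01 [Ax By]] <-].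
by have /convex_setP := @convex_hull_convex (A `|` B); apply => //;
  apply: sub_convex_hull; [left|right].
Qed.

End ConvexHull.

(** * Compactness of hulls in the topology of pointwise convergence *)

Section CompactConvexHull.
Variables (R : realType) (X : normedModType R).
Local Notation E := (R^o * {ptws X -> R^o})%type.
Implicit Types (A B : set E).

Lemma eval_continuous (v : X) :
  continuous (fun k : E => k.2 v : R^o).
Proof.
move=> k; apply: (continuous_comp (f := snd)
  (g := fun p : {ptws X -> R^o} => p v)); first exact: cvg_snd.
exact: (@proj_continuous X (fun=> R^o) v).
Qed.

Lemma prod_ptws_continuous (T : topologicalType) (f : T -> E) :
  continuous (fun z => (f z).1) -> (forall v, continuous (fun z => (f z).2 v)) ->
  continuous f.
Proof.
move=> cf1 cf2.
have pair (U V : topologicalType) (g : T -> U) (h : T -> V) :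
    continuous g -> continuous h -> continuous (fun z => (g z, h z)).
  by move=> cg ch z; apply: cvg_pair; [exact: cg|exact: ch].
have -> : f = (fun z => ((f z).1, (f z).2)) by apply/funext => z; case: (f z).
pose g z : {ptws X -> R^o} := (f z).2.
apply: (pair _ _ _ g) => // z.
 apply: (proj2 (@pointwise_cvgP X R^o (g @ z) (g z) _)) => v.
exact: cf2.
Qed.

Lemma segment_point_continuous :
  continuous (@segment_point R E : R^o * (E * E) -> E).
Proof.
have comb (T : topologicalType) (s f g : T -> R^o) :
    continuous s -> continuous f -> continuous g ->
    continuous (fun z => (1 - s z) * f z + s z * g z : R^o).
  move=> cs cf cg z.
  by apply: cvgD; apply: cvgM => //; [apply: cvgB; first exact: cvg_cst|..];
    [exact: cs|exact: cf|exact: cs|exact: cg].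
have comp (T U V : topologicalType) (f : T -> U) (g : U -> V) :
    continuous f -> continuous g -> continuous (fun z => g (f z)).
  by move=> cf cg z; apply: continuous_comp; [exact: cf|exact: cg].
have fstc (U V : topologicalType) : continuous (@fst U V).
  by move=> z; exact: cvg_fst.
have sndc (U V : topologicalType) : continuous (@snd U V).
  by move=> z; exact: cvg_snd.
pose T := (R^o * (E * E))%type.
have ck : continuous (fun z : T => z.2.1) by exact: comp (sndc _ _) (fstc _ _).
have cl : continuous (fun z : T => z.2.2) by exact: comp (sndc _ _) (sndc _ _).
apply: prod_ptws_continuous => [|v].
  apply: (comb T (fun z => z.1) (fun z => z.2.1.1) (fun z => z.2.2.1)).
  - exact: fstc.
  - exact: comp ck (fstc _ _).
  - exact: comp cl (fstc _ _).
apply: (comb T (fun z => z.1) (fun z => z.2.1.2 v) (fun z => z.2.2.2 v)).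
- exact: fstc.
- exact: comp ck (eval_continuous v).
- exact: comp cl (eval_continuous v).
Qed.

Lemma translation_continuous (k : E) : continuous (fun l : E => l + k : E).
Proof.
have add (T : topologicalType) (f : T -> R^o) (c : R^o) :
    continuous f -> continuous (fun l => f l + c : R^o).
  by move=> cf l; apply: cvgD; [exact: cf|exact: cvg_cst].
apply: prod_ptws_continuous => [|v].
  by apply: (add _ fst); move=> l; exact: cvg_fst.
exact: (add E (fun l => l.2 v) (k.2 v) (eval_continuous v)).
Qed.

Lemma affine_eval_continuous (v : X) :
  continuous (fun k : E => k.1 + k.2 v : R^o).
Proof.
have add (T : topologicalType) (f g : T -> R^o) :
    continuous f -> continuous g -> continuous (fun l => f l + g l : R^o).
  by move=> cf cg l; apply: cvgD; [exact: cf|exact: cg].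
apply: (add E fst (fun l => l.2 v)); last exact: eval_continuous.
by move=> l; exact: cvg_fst.
Qed.

Lemma compact_convex_hullU A B : compact A -> compact B ->
  convex_set A -> convex_set B -> compact (convex_hull (A `|` B) : set E).
Proof.
move=> kA kB cA cB.
have [->|/set0P A0] := eqVneq A set0; first by rewrite set0U convex_hull_id.
have [->|/set0P B0] := eqVneq B set0; first by rewrite setU0 convex_hull_id.
rewrite convex_hull_join//.
apply: (@continuous_compact (R^o * (E * E))%type E (@segment_point R E)).
  exact/continuous_subspaceT/segment_point_continuous.
apply: compact_setX; last exact: compact_setX.
have -> : [set s : R | 0 <= s <= 1] = `[0, 1]%classic.
  by apply/seteqP; split => s /=; rewrite in_itv.
exact: segment_compact.
Qed.

Lemma compact_convex_hull_bigcup (I : finType) (D : set I) (A_ : I -> set E) :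
  (forall i, D i -> compact (A_ i)) -> (forall i, D i -> convex_set (A_ i)) ->
  compact (convex_hull (\bigcup_(i in D) A_ i) : set E).
Proof.
move=> kA cA.
(* Induction over a list of indices, applied at the end to the enumeration of the whole type. *)
suff H (s : seq I) :
    compact (convex_hull (\bigcup_(i in [set i | D i /\ i \in s]) A_ i) : set E).
  have := H (enum I); congr (compact (convex_hull (bigcup _ _) : set E)).
  by apply/seteqP; split => i; [case|move=> Di; split; rewrite // mem_enum].
elim: s => [|i s IHs].
  have -> : \bigcup_(i in [set i | D i /\ i \in [::]]) A_ i = set0.
    by apply/seteqP; split => // x [i []].
  rewrite convex_hull_id; first exact: compact0.
  by apply/convex_setP.
have [Di|nDi] := pselect (D i); last first.
  suff -> : [set j | D j /\ j \in i :: s] = [set j | D j /\ j \in s] by [].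
  apply/seteqP; split => j /= [Dj]; rewrite inE.
    by move=> /predU1P[ij|//]; case: nDi; rewrite -ij.
  by move=> ->; rewrite orbT.
have -> : \bigcup_(j in [set j | D j /\ j \in i :: s]) A_ j =
    A_ i `|` \bigcup_(j in [set j | D j /\ j \in s]) A_ j.
  apply/seteqP; split => x.
    move=> [j /= [Dj]]; rewrite inE => /predU1P[-> |js] Ajx; [by left|right].
    by exists j.
  move=> [Aix|[j [Dj js] Ajx]]; first by exists i => //=; rewrite mem_head.
  by exists j => //=; rewrite inE js orbT.
rewrite -convex_hullU; apply: compact_convex_hullU => //; first exact: kA.
  exact: cA.
exact: convex_hull_convex.
Qed.

End CompactConvexHull.

(** * The open mapping theorem *)

Section OpenMapping.
Variables (R : realType) (X Y : completeNormedModType R).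

(** Common engine of the open mapping theorem and of metric regularity. The residual halves at each
    step, so the displacements are dominated by a geometric series; the iterates stay in the ball
    where the step is available and converge by completeness to a zero. *)
Lemma halving_iteration (F : X -> Y) (x0 : X) (C : R) : 0 <= C ->
  (forall x, `|x - x0| <= 2 * C * `|F x0| -> {for x, continuous F}) ->
  (forall x, `|x - x0| <= 2 * C * `|F x0| -> `|F x| <= `|F x0| ->
    exists x', `|x' - x| <= C * `|F x| /\ `|F x'| <= 2^-1 * `|F x|) ->
  exists2 z, F z = 0 & `|z - x0| <= 2 * C * `|F x0|.
Proof.
move=> C0 cF step.
(* The step is made total for [choice]; the default [0] is taken only where its conditions fail. *)
have /choice[s sP] : forall x, exists x',
    `|x - x0| <= 2 * C * `|F x0| -> `|F x| <= `|F x0| ->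
    `|x' - x| <= C * `|F x| /\ `|F x'| <= 2^-1 * `|F x|.
  move=> x; have [[xx0 Fx]|nx] :=
    pselect (`|x - x0| <= 2 * C * `|F x0| /\ `|F x| <= `|F x0|).
    by have [x' x'P] := step x xx0 Fx; exists x'.
  by exists 0 => xx0 Fx; case: nx.
set a := `|F x0| in cF step sP *; have a0 : 0 <= a by exact: normr_ge0.
pose u n := iter n s x0.
have half_ge0 n : 0 <= 2^-1 ^+ n :> R by rewrite exprn_ge0.
have ball_u n : `|u n - x0| <= 2 * C * a * (1 - 2^-1 ^+ n) ->
    `|u n - x0| <= 2 * C * a.
  move=> /le_trans; apply; rewrite ler_piMr ?mulr_ge0 // gerBl.
have small_u n : `|F (u n)| <= 2^-1 ^+ n * a -> `|F (u n)| <= a.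
  move=> /le_trans; apply; rewrite ler_piMl// exprn_ile1//.
  by rewrite invf_le1 ?ler1n.
(* The first bound is the partial sum of the series with terms [C * a * 2^-1 ^+ k], [k < n]. *)
have uP n : `|u n - x0| <= 2 * C * a * (1 - 2^-1 ^+ n) /\
    `|F (u n)| <= 2^-1 ^+ n * a.
  elim: n => [|n [un Fun]].
    by rewrite /u/= subrr normr0 expr0 subrr mulr0 mul1r.
  have [su Fsu] := sP _ (ball_u _ un) (small_u _ Fun); split; last first.
    rewrite exprS -mulrA; apply: le_trans Fsu _.
    by rewrite ler_wpM2l// invr_ge0.
  have -> : u n.+1 - x0 = (s (u n) - u n) + (u n - x0) by rewrite addrA subrK.
  apply: le_trans (ler_normD _ _) _.
  have : C * `|F (u n)| <= C * (2^-1 ^+ n * a) by rewrite ler_wpM2l.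
  rewrite exprS; nra.
have stepP n : `|u n.+1 - u n| <= geometric (C * a) 2^-1 n.
  have [un Fun] := uP n; have [su _] := sP _ (ball_u _ un) (small_u _ Fun).
  apply: le_trans su _; rewrite /= -mulrA (mulrC a).
  by rewrite ler_wpM2l.
have cvgu : cvgn u.
  have -> : u = (fun n => u 0%N + series (telescope u) n).
    by apply/funext => n; rewrite -eq_sum_telescope.
  apply: is_cvgD; first exact: is_cvg_cst.
  apply: normed_cvg; apply: series_le_cvg stepP _ => [n|n|].
  - exact: normr_ge0.
  - by rewrite geometric_ge0 ?mulr_ge0 ?invr_ge0.
  - by apply: is_cvg_geometric_series; rewrite ger0_norm; lra.
have dist : `|limn u - x0| <= 2 * C * a.
  apply: (@cvgr_to_le _ \oo _ _ (fun n => `|u n - x0|)); last first.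
    by near=> n; apply/ball_u; have [] := uP n.
  by apply: cvg_norm; apply: cvgB; [exact: cvgu|exact: cvg_cst].
exists (limn u) => //; apply/eqP; rewrite -normr_le0.
apply: (@ler_cvg_to _ \oo _ _ (fun n => `|F (u n)|) (geometric a 2^-1)).
- by apply: cvg_norm; apply: continuous_cvg => //; exact: cF.
- by apply: cvg_geometric; rewrite ger0_norm; lra.
- by near=> n; have [_] := uP n; rewrite /= mulrC.
Unshelve. all: by end_near. Qed.

(** By surjectivity the closed images of the balls of integer radius cover [Y], so by Baire one of
    them contains a ball. Differences of approximate preimages of points of that ball, rescaled,
    give approximate preimages of every [y]. *)
Lemma surjective_linear_approx (D : {linear X -> Y}) :
  set_surj [set: X] [set: Y] D ->
  exists2 C : R, 0 <= C &
    forall y, exists x, `|x| <= C * `|y| /\ `|D x - y| <= 2^-1 * `|y|.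
Proof.
move=> Dsurj.
pose O n := ~` closure (D @` [set x | `|x| <= n%:R]).
have [n [y0 [r r0 yr]]] : exists n y0, exists2 r : R, 0 < r &
    ball y0 r `<=` closure (D @` [set x | `|x| <= n%:R]).
  have [n nO] : exists n, ~ dense (O n).
    apply/existsNP => dO; have /Baire/(_ setT) : forall n, open (O n) /\ dense (O n).
      by move=> n; split => //; apply: closed_openC; exact: closed_closure.
    case; [by exists 0|exact: openT|].
    move=> y [_ Oy]; have [x _ Dx] := Dsurj y Logic.I.
    apply: (Oy (Num.truncn `|x|).+1) => //; apply: subset_closure; exists x => //=.
    by rewrite ltW// truncnS_gt.
  exists n; move/denseNE : nO => [U [[y /open_nbhs_nbhs/nbhs_ballP[r /= r0 yr]] UO]].
  exists y, r => // z /yr Uz; apply: contrapT => nz.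
  by have : (U `&` O n) z by []; rewrite UO.
have approx (y : Y) : ball y0 r y ->
    exists x, `|x| <= n%:R /\ `|D x - y| < r / 8.
  move=> /yr /(_ (ball y (r / 8)))[|_ [[x xn <-]]].
    by apply: nbhsx_ballx; lra.
  by rewrite -ball_normE /= distrC; exists x.
exists (4 * n%:R / r) => [|y]; first by rewrite divr_ge0 ?mulr_ge0// ltW.
have [->|yN0] := eqVneq y 0.
  by exists 0; rewrite linear0 subr0 !normr0 !mulr0.
have y_gt0 : 0 < `|y| by rewrite normr_gt0.
(* This point is at distance [r / 2] from the centre [y0]. The two errors [r / 8], rescaled by
   [2 / r] times the norm of [y], total half that norm. *)
have [|x1 [x1n Dx1]] := approx (y0 + (r / (2 * `|y|)) *: y).
  rewrite -ball_normE /= opprD addNKr normrN normrZ ger0_norm; last first.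
    by rewrite divr_ge0 ?mulr_ge0// ltW.
  suff -> : r / (2 * `|y|) * `|y| = r / 2 by lra.
  by field; rewrite gt_eqF.
have [|x2 [x2n Dx2]] := approx y0; first exact: ballxx.
have k_gt0 : 0 < 2 * `|y| / r by rewrite divr_gt0 ?mulr_gt0.
exists ((2 * `|y| / r) *: (x1 - x2)); split.
  rewrite normrZ gtr0_norm//.
  have : `|x1 - x2| <= 2 * n%:R.
    by apply: le_trans (ler_normB _ _) _; lra.
  rewrite -(ler_pM2l k_gt0) => /le_trans; apply.
  by rewrite le_eqVlt; apply/orP; left; apply/eqP; field; rewrite gt_eqF.
have -> : D ((2 * `|y| / r) *: (x1 - x2)) - y = (2 * `|y| / r) *:
    ((D x1 - (y0 + (r / (2 * `|y|)) *: y)) - (D x2 - y0)).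
  rewrite linearZ linearB /=.
  have {2}-> : y = (2 * `|y| / r) *: ((r / (2 * `|y|)) *: y).
    rewrite scalerA (_ : _ * _ = 1) ?scale1r//.
    by field; rewrite !gt_eqF.
  rewrite -scalerBr; congr (_ *: _).
  by rewrite -[RHS]addrA -opprD [X in _ = _ - X]addrC addrA subrK opprD addrA.
rewrite normrZ gtr0_norm//.
have : `|(D x1 - (y0 + (r / (2 * `|y|)) *: y)) - (D x2 - y0)| <= r / 4.
  by apply: le_trans (ler_normB _ _) _; lra.
rewrite -(ler_pM2l k_gt0) => /le_trans; apply.
by rewrite le_eqVlt; apply/orP; left; apply/eqP; field; rewrite gt_eqF.
Qed.

(** The approximate preimage of the residual is added repeatedly, starting from [0], where the
    residual has the norm of [y]. *)
Theorem open_mapping (D : {linear X -> Y}) : continuous D ->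
  set_surj [set: X] [set: Y] D ->
  exists2 C : R, 0 <= C & forall y, exists2 x, D x = y & `|x| <= C * `|y|.
Proof.
move=> cD sD; have [C C0 approx] := surjective_linear_approx D sD.
exists (2 * C) => [|y]; first by rewrite mulr_ge0.
have [x _|x _ _|z] := @halving_iteration (fun x => D x - y) 0 C C0.
- by apply: cvgB; [exact: cD|exact: cvg_cst].
- have [h [hC hD]] := approx (y - D x); exists (x + h).
  rewrite addrC addKr -(normrN (D x - y)) opprB; split => //.
  by rewrite linearD [D x + _]addrC -addrA -(opprB y).
by rewrite subr0 linear0 sub0r normrN => /subr0_eq; exists z.
Qed.

End OpenMapping.

(** * Differentiable maps *)

Section DifferentiableMaps.
Variables (R : realType).

Lemma differentiable_approx (V W : normedModType R) (F : V -> W) (x : V)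
    (e : R) : differentiable F x -> 0 < e ->
  \forall h \near 0, `|F (x + h) - F x - 'd F x h| <= e * `|h|.
Proof.
move=> /diff_locallyP[_ /eqaddoP dF] e0.
near=> h.
have : `|(F \o shift x - (cst (F x) + 'd F x)) h| <= e * `|h| by near: h; exact: dF.
by rewrite !fctE /= opprD addrA (addrC h).
Unshelve. all: by end_near. Qed.

(** For vector values there is no intermediate point to use. Instead [phi] is shown to be maximal on
    the unit interval at [0]; then [phi 1 <= phi 0 = 0] is the bound with [M + e], and [e] is
    arbitrary. *)
Lemma mean_value_le (V W : normedModType R) (G : V -> W) (a b : V) (M : R) :
  (forall t : R, 0 <= t <= 1 -> differentiable G (a + t *: (b - a)) /\
     `|'d G (a + t *: (b - a)) (b - a)| <= M) ->
  `|G b - G a| <= M.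
Proof.
move=> dG; apply/ler_addgt0Pr => e e0.
pose c t := a + t *: (b - a).
pose phi t := `|G (c t) - G a| - (M + e) * t.
have cc : continuous c.
  by move=> t; apply: cvgD; [exact: cvg_cst|apply: cvgZr_tmp; exact: cvg_id].
have [|t0 t01 maxphi] := @EVT_max R phi 0 1 ler01.
  rewrite continuous_subspace_in => t /set_mem/=; rewrite in_itv/= => t01.
  apply: continuous_subspaceT_for; first by rewrite /= in_itv.
  apply: cvgB; last by apply: cvgM; [exact: cvg_cst|exact: cvg_id].
  apply: cvg_norm; apply: cvgB; last exact: cvg_cst.
  apply: (continuous_comp (f := c) (g := G)); first exact: cc.
  exact: differentiable_continuous (dG _ t01).1.
suff t00 : t0 = 0.
  have := maxphi 1; rewrite in_itv/= ler01 lexx t00 => /(_ isT).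
  rewrite /phi /c scale0r addr0 subrr normr0 mulr0 subr0 scale1r mulr1.
  by rewrite addrCA subrr addr0 subr_le0.
(* To the left of a maximum point [t0 > 0], [phi] would decrease too slowly:
   the slope of [`|G (c t) - G a|] is at most [M] there. *)
apply/eqP; rewrite eq_le; move: t01; rewrite in_itv/= => /[dup] t01 /andP[-> t1].
rewrite andbT leNgt; apply/negP => t0_gt0.
have [dGt dGM] := dG _ t01.
pose m := `|b - a| + 1.
have m_gt0 : 0 < m by rewrite /m ltr_wpDl.
have em_gt0 : 0 < e / (2 * m) by rewrite divr_gt0// mulr_gt0.
have /nbhs_norm0P[d /= d0 dP] := differentiable_approx _ _ _ _ _ dGt em_gt0.
(* The step to the left stays in the unit interval and within the radius of the first-order
   estimate. *)
pose r := Num.min t0 (d / (2 * m)).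
have r_gt0 : 0 < r by rewrite lt_min t0_gt0 divr_gt0// mulr_gt0.
have rt : r <= t0 by rewrite ge_min lexx.
have rm : r * m < d.
  have : r <= d / (2 * m) by rewrite ge_min lexx orbT.
  by rewrite ler_pdivlMr ?mulr_gt0//; lra.
have rbd : r * `|b - a| < d by rewrite /m in rm; lra.
have := dP (- (r *: (b - a))); rewrite /= normrN normrZ gtr0_norm// => /(_ rbd).
have -> : a + t0 *: (b - a) - r *: (b - a) = c (t0 - r).
  by rewrite /c scalerBl addrA.
rewrite linearN linearZ /= opprK -/(c t0) => Gr.
have rem : e / (2 * m) * (r * `|b - a|) <= e * r / 2.
  have -> : e / (2 * m) * (r * `|b - a|) = (e * r / 2) * (`|b - a| / m).
    by field; rewrite gt_eqF.
  rewrite ler_piMr ?divr_ge0 ?mulr_ge0 ?ltW//.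
  by rewrite ltr_pdivrMr// mul1r /m ltrDl.
have /maxphi : t0 - r \in `[0, 1] by rewrite in_itv/= subr_ge0 rt; lra.
rewrite /phi.
have : `|G (c t0) - G a| <= `|G (c (t0 - r)) - G a| +
   `|G (c (t0 - r)) - G (c t0) + r *: 'd G (c t0) (b - a)| +
   r * `|'d G (c t0) (b - a)|.
  rewrite -[X in _ + X * _]gtr0_norm// -normrZ.
  have -> : G (c t0) - G a = (G (c (t0 - r)) - G a) -
      (G (c (t0 - r)) - G (c t0) + r *: 'd G (c t0) (b - a)) +
      r *: 'd G (c t0) (b - a).
    by rewrite opprD addrA subrK opprB [RHS]addrC addrA subrK.
  by apply: le_trans (ler_normD _ _) _; rewrite lerD2r ler_normB.
have : r * `|'d G (c t0) (b - a)| <= r * M by rewrite ler_pM2l.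
have er : 0 < e * r by rewrite mulr_gt0.
lra.
Qed.
End DifferentiableMaps.

(** * Lyusternik's theorem *)

Section Lyusternik.
Variables (R : realType) (X Y : completeNormedModType R) (F : X -> Y) (xs : X).

(** [w] is a displacement: the path itself is [xs + w t], and [w t = t *: v + o(t)] from the
    right. *)
Definition tangent (V : normedModType R) (w : R -> V) (v : V) :=
  forall e, 0 < e -> \forall t \near 0^'+, `|w t - t *: v| <= e * t.

Lemma tangent_cvg0 (V : normedModType R) (w : R -> V) (v : V) :
  tangent V w v -> w t @[t --> 0^'+] --> 0.
Proof.
move=> tw; have m0 : 0 < `|v| + 1 by rewrite ltr_wpDl.
apply/cvgr0Pnorm_lt => d d0; near=> t.
have t0 : 0 < t by near: t; exact: nbhs_right_gt.
have td : t < d / (`|v| + 1).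
  by near: t; apply: nbhs_right_lt; rewrite divr_gt0.
rewrite ltr_pdivlMr// in td; apply: le_lt_trans td.
have -> : w t = t *: v + (w t - t *: v) by rewrite addrC subrK.
apply: le_trans (ler_normD _ _) _; rewrite normrZ gtr0_norm//.
by rewrite mulrDr lerD2l mulrC; near: t; exact: tw.
Unshelve. all: by end_near. Qed.

(** The mean value bound is applied to [F] minus its derivative at [xs], a map whose own derivative
    is small near [xs]. *)
Lemma strict_differentiability : continuously_differentiable_at F xs ->
  forall e, 0 < e -> exists2 d, 0 < d & forall a b,
    `|a - xs| < d -> `|b - xs| < d ->
    `|F b - F a - 'd F xs (b - a)| <= e * `|b - a|.
Proof.
move=> [dF cdF] e e0.
have /nbhs_normP[d /= d0 dP] : \forall z \near xs, differentiable F z /\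
    forall h, `|'d F z h - 'd F xs h| <= e * `|h|.
  by near=> z; split; [near: z; exact: dF | near: z; exact: cdF].
exists d => // a b ad bd.
have cD : continuous ('d F xs).
  exact/diff_continuous/(nbhs_singleton dF).
have -> : F b - F a - 'd F xs (b - a) =
    (F - ('d F xs : X -> Y)) b - (F - ('d F xs : X -> Y)) a.
  rewrite linearB /= -[RHS]/((F b - 'd F xs b) - (F a - 'd F xs a)).
  by rewrite !opprB addrACA [RHS]addrACA [- F a - _]addrC.
apply: mean_value_le => t /andP[t0 t1].
(* The ball is convex, so it contains the segment from [a] to [b]. *)
have /dP[dFt dFxs] : `|xs - (a + t *: (b - a))| < d.
  rewrite distrC.
  have -> : a + t *: (b - a) - xs = (1 - t) *: (a - xs) + t *: (b - xs).
    rewrite scalerBl scale1r -[RHS]addrA [in RHS](addrC (- _)) -scalerBr opprB.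
    by rewrite addrA subrK addrAC.
  apply: le_lt_trans (ler_normD _ _) _.
  rewrite !normrZ !ger0_norm// ?subr_ge0//.
  by have [ab|ab] := leP `|a - xs| `|b - xs|; nra.
have dD := @linear_differentiable _ _ _ _ (a + t *: (b - a)) cD.
split; first exact: differentiableB.
by rewrite diffB//= diff_lin.
Unshelve. all: by end_near. Qed.

(** A Newton-like iteration with the derivative frozen at [xs]: the correction [h] solves the
    linearised equation with norm at most [C] times the residual, and strict differentiability with
    constant [(2 * (C + 1))^-1] halves the residual. *)
Lemma metric_regularity : continuously_differentiable_at F xs ->
  set_surj [set: X] [set: Y] ('d F xs) -> F xs = 0 ->
  exists2 k, 0 <= k & \forall x \near xs,
    exists2 z, F z = 0 & `|z - x| <= k * `|F x|.
Proof.
move=> F1 surjD F0; have dF : differentiable F xs by exact: nbhs_singleton F1.1.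
have [C C0 DC] := @open_mapping _ _ _ _ (diff_continuous dF) surjD.
have e0 : 0 < (2 * (C + 1))^-1 by rewrite invr_gt0 mulr_gt0// ltr_wpDl.
have [d d0 dP] := strict_differentiability F1 _ e0.
have /nbhs_normP[d1 /= d10 d1P] := F1.1.
exists (2 * C); first by rewrite mulr_ge0.
have m0 : 0 < Num.min d d1 by rewrite lt_min d0.
have Fx0 : F x @[x --> xs] --> 0.
  by rewrite -F0; exact: differentiable_continuous.
near=> x.
have xd : `|x - xs| < Num.min d d1 / 2.
  near: x; apply/nbhs_normP; exists (Num.min d d1 / 2) => /=; first lra.
  by move=> x; rewrite /= distrC.
(* Iterates move by at most [2 * C] residuals of [x], and one further step adds at most [C] more. *)
have Fxd : 3 * C * `|F x| < Num.min d d1 / 2.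
  have : `|F x| < Num.min d d1 / (6 * (C + 1)).
    near: x; apply: cvgr0_norm_lt => //.
    by rewrite divr_gt0// mulr_gt0// ltr_wpDl.
  rewrite ltr_pdivlMr ?mulr_gt0 ?ltr_wpDl//.
  have := normr_ge0 (F x); nra.
have CF0 : 0 <= C * `|F x| by rewrite mulr_ge0.
have near_xs z : `|z - x| <= 3 * C * `|F x| -> `|z - xs| < Num.min d d1.
  move=> zx; have -> : z - xs = (z - x) + (x - xs) by rewrite addrA subrK.
  by apply: le_lt_trans (ler_normD _ _) _; lra.
have near_xs2 z : `|z - x| <= 2 * C * `|F x| -> `|z - xs| < Num.min d d1.
  by move=> zx; apply: near_xs; lra.
apply: halving_iteration => // z zx.
  apply: differentiable_continuous; apply: d1P; rewrite /= distrC.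
  by apply: lt_le_trans (near_xs2 _ zx) _; rewrite ge_min lexx orbT.
move=> Fzx; have [h Dh hC] := DC (- F z); exists (h + z).
rewrite addrK; rewrite normrN in hC; split => //.
have zd : `|z - xs| < d.
  by apply: lt_le_trans (near_xs2 _ zx) _; rewrite ge_min lexx.
have zhd : `|h + z - xs| < d.
  apply: lt_le_trans (near_xs (h + z) _) _; last by rewrite ge_min lexx.
  rewrite -addrA; apply: le_trans (ler_normD _ _) _.
  have : C * `|F z| <= C * `|F x| by rewrite ler_wpM2l.
  lra.
have := dP _ _ zd zhd; rewrite addrK Dh opprK subrK => /le_trans; apply.
have : (2 * (C + 1))^-1 * `|h| <= (2 * (C + 1))^-1 * (C * `|F z|).
  by rewrite ler_wpM2l// ltW.
move=> /le_trans; apply; rewrite mulrA ler_wpM2r//.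
by rewrite invfM -mulrA ler_piMr ?invr_ge0// mulrC ler_pdivrMr; lra.
Unshelve. all: by end_near. Qed.

(** The point [xs + t *: v] is moved to a zero of [F] at a cost proportional to its residual, which
    is [o(t)] because [F xs = 0] and ['d F xs v = 0]. *)
Lemma lyusternik (v : X) : continuously_differentiable_at F xs ->
  set_surj [set: X] [set: Y] ('d F xs) -> F xs = 0 -> 'd F xs v = 0 ->
  exists2 w : R -> X, tangent _ w v & \forall t \near 0^'+, F (xs + w t) = 0.
Proof.
move=> F1 surjD F0 Dv; have dF : differentiable F xs by exact: nbhs_singleton F1.1.
have [k k0 /nbhs0P kP] := metric_regularity F1 surjD F0.
have tv0 : (t *: v : X) @[t --> 0^'+] --> 0.
  rewrite -(scale0r v); apply: cvg_at_right_filter.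
  by apply: cvgZr_tmp; exact: cvg_id.
(* The default [0] is harmless: a nearby zero exists for all small [t > 0]. *)
have /choice[z zP] : forall t, exists z,
    (exists2 z, F z = 0 & `|z - (xs + t *: v)| <= k * `|F (xs + t *: v)|) ->
    F z = 0 /\ `|z - (xs + t *: v)| <= k * `|F (xs + t *: v)|.
  move=> t; have [[z Fz zt]|nz] := pselect (exists2 z, F z = 0 &
    `|z - (xs + t *: v)| <= k * `|F (xs + t *: v)|); first by exists z.
  by exists 0.
exists (fun t => z t - xs) => [e e0|]; last first.
  near=> t; rewrite subrKC; apply: (zP t _).1.
  by near: t; exact: tv0 _ kP.
have m_gt0 : 0 < (k + 1) * (`|v| + 1) by rewrite mulr_gt0 ?ltr_wpDl.
(* The added ones keep the denominator positive even if [k] or [v] vanishes. *)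
have em_gt0 : 0 < e / ((k + 1) * (`|v| + 1)) by rewrite divr_gt0.
have approx := differentiable_approx _ _ _ _ _ _ dF em_gt0.
near=> t.
have t0 : 0 < t by near: t; exact: nbhs_right_gt.
have [|_] := zP t; first by near: t; exact: tv0 _ kP.
rewrite -addrA -opprD => /le_trans; apply.
have : `|F (xs + t *: v) - F xs - 'd F xs (t *: v)| <=
    e / ((k + 1) * (`|v| + 1)) * `|t *: v|.
  by near: t; exact: tv0 _ approx.
rewrite F0 subr0 linearZ /= Dv scaler0 subr0 normrZ gtr0_norm//.
move=> /(ler_wpM2l k0)/le_trans; apply.
have -> : k * (e / ((k + 1) * (`|v| + 1)) * (t * `|v|)) =
    (e * t) * ((k / (k + 1)) * (`|v| / (`|v| + 1))).
  by field; rewrite !gt_eqF// ltr_wpDl.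
have frac01 (u : R) : 0 <= u -> 0 <= u / (u + 1) <= 1.
  move=> u0; rewrite divr_ge0 ?addr_ge0//=.
  by rewrite ler_pdivrMr ?ltr_wpDl// mul1r lerDl.
have /andP[? ?] := frac01 _ k0; have /andP[? ?] := frac01 _ (normr_ge0 v).
rewrite ler_piMr//; first by rewrite mulr_ge0// ltW.
exact: mulr_ile1.
Unshelve. all: by end_near. Qed.

End Lyusternik.

(** * Codifferentiable functions *)

Section CodifferentiableFunctions.
Variables (R : realType) (X : normedModType R).

Lemma linear_packed (p : X -> R^o) : linear p ->
  exists P : {linear X -> R^o}, p = P.
Proof.
move=> lp; pose P : {linear X -> R^o} :=
  HB.pack p (GRing.isLinear.Build _ _ _ _ p lp).
by exists P.
Qed.

(** The uniform bound on the unit ball extends by homogeneity. Its absolute value is taken since for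
    empty [A] the bound may be negative. *)
Lemma uniform_bounded_lipschitz (A : set (X -> R^o)) :
  A `<=` (fun p => linear p) -> uniform_bounded A ->
  exists2 M, 0 <= M & forall p, A p -> forall h, `|p h| <= M * `|h|.
Proof.
move=> linA /(_ 1)[M MP]; exists `|M| => [//|p Ap h].
have [P pP] := linear_packed _ (linA _ Ap).
have [->|h0] := eqVneq h 0; first by rewrite pP linear0 !normr0 mulr0.
have h_gt0 : 0 < `|h| by rewrite normr_gt0.
have : `|p (`|h|^-1 *: h)| <= M.
  by apply: MP => //; rewrite normrZ normfV normr_id mulVf// gt_eqF.
rewrite pP linearZ /= normrZ normfV normr_id mulrC ler_pdivrMr// => /le_trans.
by apply; rewrite ler_wpM2r// ler_norm.
Qed.

Variables (f : X -> R) (x : X) (dl du : set (R^o * (X -> R^o))).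
Hypothesis f_codiff : is_codifferential f x dl du.
Hypothesis f_norm : codiff_normalized dl du.

Lemma hypodifferential_le0 (ap : R^o * (X -> R^o)) : dl ap -> ap.1 <= 0.
Proof. by move=> dlap; apply: f_norm.1.2; exists ap. Qed.

Lemma codifferential_lipschitz : exists2 M, 0 <= M &
  forall ap, dl ap \/ du ap -> forall h, `|ap.2 h| <= M * `|h|.
Proof.
have [dlP duP _] := f_codiff.
have [|M M0 MP] := @uniform_bounded_lipschitz (snd @` dl) _ (codiff_set_bounded dlP).2.
  by move=> _ [ap dlap <-]; have [] := codiff_set_dual dlP dlap.
have [|N N0 NP] := @uniform_bounded_lipschitz (snd @` du) _ (codiff_set_bounded duP).2.
  by move=> _ [ap duap <-]; have [] := codiff_set_dual duP duap.
exists (M + N) => [|ap [dap|dap] h]; first exact: addr_ge0.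
  apply: le_trans (MP _ _ h) _; first by exists ap.
  by rewrite ler_wpM2r// lerDl.
apply: le_trans (NP _ _ h) _; first by exists ap.
by rewrite ler_wpM2r// lerDr.
Qed.

(** The maximum is attained at some [ap] depending on [h], and the minimum is at most the value of
    the chosen [(0, q)]. *)
Lemma codifferential_le (q : X -> R^o) (e : R) : du (0, q) -> 0 < e ->
  \forall h \near 0, exists2 ap, dl ap &
    f (x + h) - f x <= ap.1 + ap.2 h + q h + e * `|h|.
Proof.
move=> duq e0; have [_ _ [Phi [Psi [PhiP PsiP /eqoP o_f]]]] := f_codiff.
near=> h.
have [[ap dlap apE] _] := PhiP h; exists ap => //.
have Psi_le : Psi h <= q h by apply: (PsiP h).2; exists (0, q) => //=; rewrite add0r.
have : `|f (x + h) - f x - (Phi h + Psi h)| <= e * `|h|.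
  by near: h; exact: o_f.
rewrite apE => /(le_trans (ler_norm _)); lra.
Unshelve. all: by end_near. Qed.

(** Serves the inactive constraints. Normalisation provides some [(0, q)] in [du]; as [ap.1 <= 0],
    the increment is at most [2 * M + 1] times the norm of [w t]. *)
Lemma codifferential_continuous_le (w : R -> X) (c : R) :
  w t @[t --> 0^'+] --> 0 -> f x < c -> \forall t \near 0^'+, f (x + w t) < c.
Proof.
move=> w0 fxc; have [[bq dubq bq0] _] := f_norm.2.
have duq : du (0, bq.2) by case: bq dubq bq0 => b q /= + <-.
have [M M0 MP] := codifferential_lipschitz.
have approx := codifferential_le _ _ duq ltr01.
near=> t.
have [ap dlap] : exists2 ap, dl ap &
    f (x + w t) - f x <= ap.1 + ap.2 (w t) + bq.2 (w t) + 1 * `|w t|.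
  by near: t; exact: w0 _ approx.
have := hypodifferential_le0 _ dlap.
have := le_trans (ler_norm _) (MP _ (or_introl dlap) (w t)).
have := le_trans (ler_norm _) (MP _ (or_intror duq) (w t)).
have : `|w t| < (c - f x) / (2 * M + 1).
  near: t; apply: cvgr0_norm_lt => //; rewrite divr_gt0 ?subr_gt0//; lra.
rewrite ltr_pdivlMr; last lra.
rewrite /=; lra.
Unshelve. all: by end_near. Qed.

(** The maximising [ap] varies with [t], so a uniform gap is needed: the maximum [Phi v] is
    attained, hence every sum is at most [- c] with [c > 0]. *)
Lemma codifferential_descent (q : X -> R^o) (v : X) (w : R -> X) :
  du (0, q) -> tangent R X w v ->
  (forall ap, dl ap -> ap.1 + ap.2 v + q v < 0) ->
  \forall t \near 0^'+, f (x + w t) < f x.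
Proof.
move=> duq tw neg; have [dlP duP [Phi [Psi [PhiP PsiP _]]]] := f_codiff.
have [M M0 MP] := codifferential_lipschitz.
pose c := - (Phi v + q v).
have c0 : 0 < c by rewrite oppr_gt0; have [[ap dlap <-] _] := PhiP v; exact: neg.
have PhiP' ap : dl ap -> ap.1 + ap.2 v + q v <= - c.
  by move=> dlap; rewrite opprK lerD2r; apply: (PhiP v).2; exists ap.
(* Error budget: the two Lipschitz errors take at most [c * t / 2] together and the remainder
   [c * t / 4], leaving a strict decrease. *)
pose r := c / (4 * (M + 1)).
have r0 : 0 < r by rewrite divr_gt0// mulr_gt0// ltr_wpDl.
have rE : r * (M + 1) * 4 = c by rewrite /r; field; lra.
pose e := c / (4 * (`|v| + r)).
have vr0 : 0 < `|v| + r by rewrite ltr_wpDl.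
have e0 : 0 < e by rewrite divr_gt0// mulr_gt0.
have eE : e * (`|v| + r) * 4 = c by rewrite /e; field; lra.
have approx := codifferential_le _ _ duq e0.
have w0 := tangent_cvg0 _ _ _ _ tw.
near=> t.
have t0 : 0 < t by near: t; exact: nbhs_right_gt.
have t1 : t < 1 by near: t; exact: nbhs_right_lt.
have wt : `|w t - t *: v| <= r * t by near: t; exact: tw.
have [ap dlap] : exists2 ap, dl ap &
    f (x + w t) - f x <= ap.1 + ap.2 (w t) + q (w t) + e * `|w t|.
  by near: t; exact: w0 _ approx.
have split_w (p : X -> R^o) : linear p -> p (w t) = t * p v + p (w t - t *: v).
  by move=> lp; have [P ->] := linear_packed _ lp; rewrite linearB linearZ /= addrC subrK.
have [lin_ap _] := codiff_set_dual dlP dlap.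
have [lin_q _] := codiff_set_dual duP duq.
rewrite (split_w _ lin_ap) (split_w q lin_q).
have := PhiP' _ dlap; have := hypodifferential_le0 _ dlap.
have : `|w t| <= (`|v| + r) * t.
  have -> : w t = t *: v + (w t - t *: v) by rewrite addrC subrK.
  apply: le_trans (ler_normD _ _) _; rewrite normrZ gtr0_norm//; lra.
move=> /(ler_wpM2l (ltW e0)).
have := le_trans (ler_norm _) (MP _ (or_introl dlap) (w t - t *: v)).
have := le_trans (ler_norm _) (MP _ (or_intror duq) (w t - t *: v)).
move: (ler_wpM2l M0 wt).
rewrite /=.
set A := ap.2 _; set B := q (w t - _); set W := M * `|_ - _|.
move=> WM BW AW ew ap0 apc.
have : t * (ap.1 + ap.2 v + q v) <= t * - c by rewrite ler_pM2l.
(* Since [ap.1 <= 0] and [t < 1]. *)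
have : ap.1 <= t * ap.1 by nra.
have : c * t = e * (`|v| + r) * 4 * t by rewrite eE.
have : c * t = r * (M + 1) * 4 * t by rewrite rE.
have : 0 < c * t by rewrite mulr_gt0.
have : 0 < r * t by rewrite mulr_gt0.
nra.
Unshelve. all: by end_near. Qed.

End CodifferentiableFunctions.

(** * Existence of the multiplier *)

Section DualFactorization.
Variables (R : realType) (X Y : completeNormedModType R).

Lemma linear_bounded_dual (l : Y -> R^o) (k : R) :
  linear l -> (forall y, `|l y| <= k * `|y|) -> dual l.
Proof.
move=> ll lk; split => //; have [P lP] := linear_packed _ _ _ ll.
rewrite lP; apply/linear_bounded_continuous/ex_bound; exists `|k|.
near=> y; rewrite -lP; apply: le_trans (lk y) _.
have : `|y| <= 1 by near: y; apply: cvgr0_norm_le => //; exact: cvg_id.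
by have := ler_norm k; have := normr_ge0 y; have := normr_ge0 k; nra.
Unshelve. all: by end_near. Qed.

(** [p] is constant on the fibres of [D], so composing it with any selection [g] of preimages gives
    a linear map, though [g] itself may not be linear. The open mapping bound on [g] makes it
    continuous. *)
Lemma dual_factor (D : {linear X -> Y}) (p : X -> R^o) : continuous D ->
  set_surj [set: X] [set: Y] D -> dual p -> (forall v, D v = 0 -> p v = 0) ->
  exists2 ystar, dual ystar & p = ystar \o D.
Proof.
move=> cD sD [lp cp] pker.
have [P pP] := linear_packed _ _ _ lp; rewrite pP in cp pker *.
have [C C0 DC] := open_mapping _ _ _ _ cD sD.
have [M M0 PM] := linear_lipschitz cp.
have /choice[g gP] : forall y, exists x, D x = y /\ `|x| <= C * `|y|.
  by move=> y; have [x Dx xC] := DC y; exists x.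
have Pg x y : D x = y -> P x = P (g y).
  move=> Dx; apply/subr0_eq; rewrite -linearB; apply: pker.
  by rewrite linearB Dx (gP y).1 subrr.
exists (P \o g); last by apply/funext => x /=; exact: Pg.
apply: (@linear_bounded_dual _ (M * C)) => [a y z|y] /=.
  by rewrite -linearP; apply/esym/Pg; rewrite linearP (gP y).1 (gP z).1.
apply: le_trans (PM _) _; rewrite -mulrA ler_wpM2l ?(ltW M0)//.
exact: (gP y).2.
Qed.

End DualFactorization.

(** Carries the sign of the first component and membership in the dual from the generators to their
    convex hull. *)
Lemma convex_nonpos_dual (R : realType) (X : normedModType R) :
  convex_set [set k : R^o * (X -> R^o) | k.1 <= 0 /\ dual k.2].
Proof.
apply/convex_setP => k l s [k0 [lk ck]] [l0 [ll cl]] /andP[s0 s1]; split => /=.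
  have := ler_wpM2l s0 l0; rewrite mulr0.
  have : (1 - s) * k.1 <= 0 by rewrite mulr_ge0_le0// subr_ge0.
  by rewrite /GRing.scale/=; lra.
split; last first.
  by move=> x; apply: cvgD; apply: cvgM;
    [exact: cvg_cst|exact: ck|exact: cvg_cst|exact: cl].
move=> a x y; rewrite !fctE lk ll /GRing.scale/=; ring.
Qed.

Lemma critical_direction (R : realType) (X Y : completeNormedModType R)
    (n : nat) (f : 'I_n.+1 -> X -> R) (F : X -> Y) (xs : X)
    (dl du : 'I_n.+1 -> set (R^o * (X -> R^o))) (q : 'I_n.+1 -> X -> R^o) (v : X) :
  continuously_differentiable_at F xs ->
  (forall i, is_codifferential (f i) xs (dl i) (du i)) ->
  (forall i, codiff_normalized (dl i) (du i)) ->
  set_surj [set: X] [set: Y] ('d F xs) ->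
  local_minimum f F xs ->
  (forall i, active f xs i -> du i (0, q i)) -> 'd F xs v = 0 ->
  exists i, active f xs i /\ exists2 ap, dl i ap & 0 <= ap.1 + ap.2 v + q i v.
Proof.
move=> F1 f_codiff f_norm sD [[F0 f_le0] xs_min] q_du Dv.
apply: contrapT => none.
have neg i ap : active f xs i -> dl i ap -> ap.1 + ap.2 v + q i v < 0.
  move=> act dlap; rewrite ltNge; apply/negP => ge0; apply: none.
  by exists i; split => //; exists ap.
have [w tw Fw] := lyusternik _ _ _ _ _ _ F1 sD F0 Dv.
have w0 := tangent_cvg0 _ _ _ _ tw.
have decrease i : active f xs i -> \forall t \near 0^'+, f i (xs + w t) < f i xs.
  move=> act; apply: codifferential_descent (q_du _ act) tw _ => // ap.
  exact: neg.
(* Active constraints decrease from zero; inactive ones stay negative by one-sided continuity. *)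
have feas i : i != ord0 -> \forall t \near 0^'+, f i (xs + w t) < 0.
  move=> i0; have [fi0|fi0] := eqVneq (f i xs) 0.
    by have := decrease i (or_intror (conj i0 fi0)); rewrite fi0.
  apply: (codifferential_continuous_le _ _ _ _ _ _ (f_codiff i)) => //.
  by rewrite lt_neqAle fi0 f_le0.
have feas_all : \forall t \near 0^'+, forall i : 'I_n.+1,
    i != ord0 -> f i (xs + w t) < 0.
  apply: filter_forall => i; have [->|i0] := eqVneq i ord0.
    by near=> t.
  by apply: filterS (feas _ i0).
have min_w : \forall t \near 0^'+,
    feasible f F (xs + w t) -> f ord0 xs <= f ord0 (xs + w t).
  have xw : xs + w t @[t --> 0^'+] --> xs.
    by rewrite -[X in _ --> X]addr0; apply: cvgD => //; exact: cvg_cst.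
  exact: xw _ xs_min.
have dec0 := decrease ord0 (or_introl erefl).
near (0 : R)^'+ => t.
have : f ord0 (xs + w t) < f ord0 xs by near: t.
rewrite ltNge => /negP; apply.
suff feas_t : feasible f F (xs + w t) by move: feas_t; near: t.
split; first by near: t.
by move=> i i0; apply/ltW; move: i i0; near: t.
Unshelve. all: by end_near. Qed.

Theorem proposition5p11 (R : realType) (X Y : completeNormedModType R)
    (n : nat) (f : 'I_n.+1 -> X -> R) (F : X -> Y) (xs : X)
    (dl du : 'I_n.+1 -> set (R^o * (X -> R^o)))
    (F_C1 : continuously_differentiable_at F xs)
    (f_codiff : forall i, is_codifferential (f i) xs (dl i) (du i))
    (f_norm : forall i, codiff_normalized (dl i) (du i))
    (dF_surj : set_surj [set: X] [set: Y] ('d F xs))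
    (xs_min : local_minimum f F xs)
    (q : 'I_n.+1 -> X -> R^o)
    (q_du : forall i, active f xs i -> du i (0, q i)) :
  exists2 ystar : Y -> R^o, dual ystar &
    convex_hull
      (\bigcup_(i in active f xs) [set ap + (0, q i) | ap in dl i])
      (0, ystar \o 'd F xs).
Proof.
have dF : differentiable F xs by exact: nbhs_singleton F_C1.1.
set S := \bigcup_(i in _) _; set K := convex_hull S.
have convK : forall k l (s : R), K k -> K l -> 0 <= s <= 1 ->
    K ((1 - s) *: k + s *: l).
  by apply/convex_setP; exact: convex_hull_convex.
have compactK : compact (K : set (R^o * {ptws X -> R^o})%type).
  apply: compact_convex_hull_bigcup => i act.
    apply: (@continuous_compact (R^o * {ptws X -> R^o})%type
      (R^o * {ptws X -> R^o})%type (fun ap => ap + (0, q i))).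
      exact/continuous_subspaceT/translation_continuous.
    by have [dlP _ _] := f_codiff i; exact: codiff_set_compact.
  apply/convex_setP => _ _ s [ap dlap <-] [bp dlbp <-] s01.
  have [dlP _ _] := f_codiff i.
  exists ((1 - s) *: ap + s *: bp).
    by have /convex_setP := codiff_set_convex dlP; exact.
  by rewrite !scalerDr addrACA -scalerDl subrK scale1r.
have K_sub : K `<=` [set k | k.1 <= 0 /\ dual k.2].
  apply: convex_hull_min; first exact: convex_nonpos_dual.
  move=> _ [i act [ap dlap <-]] /=; have [dlP duP _] := f_codiff i.
  rewrite addr0; split.
    exact: hypodifferential_le0 (f_norm i) _ dlap.
  have [lap cap] := codiff_set_dual dlP dlap.
  have [/= lq cq] := codiff_set_dual duP (q_du i act).
  split; last by move=> x; apply: cvgD; [exact: cap|exact: cq].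
  by move=> a x y; rewrite !fctE lap lq scalerDr addrACA.
pose e (v : X) (k : R^o * {ptws X -> R^o}) : R := k.1 + k.2 v.
have e_ge0 v : 'd F xs v = 0 -> exists2 k, K k & 0 <= e v k.
  move=> Dv; have [i [act [ap dlap ge0]]] :=
    critical_direction _ _ _ _ _ _ _ _ _ _ _ F_C1 f_codiff f_norm dF_surj xs_min q_du Dv.
  exists (ap + (0, q i)); first by apply: sub_convex_hull; exists i => //; exists ap.
  by rewrite /e/= addr0 addrA.
(* Both convexity conditions hold with equality: [e] is affine in the point of [K] and, the second
   components being linear, also in the direction. *)
have [||v Dv|k l s Kk Kl s01|v w s Dv Dw s01|//|k Kk kP] :=
    @convexlike_minimax R (R^o * {ptws X -> R^o})%type X
      [set v | 'd F xs v = 0] e K.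
- exact: compactK.
- by have [|k Kk _] := e_ge0 0; [rewrite linear0|exists k].
- exact: affine_eval_continuous.
- exists ((1 - s) *: k + s *: l); first exact: convK.
  move=> v _; rewrite le_eqVlt; apply/orP; left; apply/eqP.
  rewrite /e /= -[RHS]/(((1 - s) * k.1 + s * l.1) +
    ((1 - s) * k.2 v + s * l.2 v)); ring.
- exists ((1 - s) *: v + s *: w).
    by rewrite /= linearD !linearZ /= Dv Dw !scaler0 addr0.
  move=> k /K_sub[_ [lk _]]; rewrite le_eqVlt; apply/orP; left; apply/eqP.
  have [P kP] := linear_packed _ _ _ lk.
  rewrite /e kP linearD !linearZ /= /GRing.scale/=; ring.
have [k_le0 kdual] := K_sub _ Kk; have [P kE] := linear_packed _ _ _ kdual.1.
have k0 : k.1 = 0.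
  apply/eqP; rewrite eq_le k_le0 /=.
  have := kP 0; rewrite /e kE /= !linear0 addr0; exact.
have ker_k v : 'd F xs v = 0 -> k.2 v = 0.
  move=> Dv; apply/eqP; rewrite eq_le.
  have := kP v Dv; rewrite /e k0 add0r => ->; rewrite andbT.
  have := kP (- v); rewrite /e k0 add0r /= linearN Dv oppr0 => /(_ erefl).
  by rewrite kE linearN oppr_ge0.
have [ystar ydual kyD] := dual_factor _ _ _ _ _ (diff_continuous dF) dF_surj kdual ker_k.
exists ystar => //; rewrite -kyD.
by move: Kk; rewrite /K /S; case: (k) k0 => a p /= ->.
Qed.
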